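(* For any algebra $A\in\mathcal{V}$ such that $K(A)$ is closed under the commutator operation, the following are equivalent: (1) $A$ is an $mp$-algebra; (2) for all congruences $\alpha,\beta\in K(A)$, $[\alpha,\beta]\subseteq\rho(\Delta_A)$ implies $(\alpha\rightarrow\rho(\Delta_A))\vee(\beta\rightarrow\rho(\Delta_A))=\nabla_A$; (3) for all congruences $\alpha,\beta\in K(A)$, $(\alpha\rightarrow\rho(\Delta_A))\vee(\beta\rightarrow\rho(\Delta_A))=[\alpha,\beta]\rightarrow\rho(\Delta_A)$; (4) for any $\alpha\in K(A)$, $\alpha\rightarrow\rho(\Delta_A)$ is a $w$-pure congruence of $A$.
   Context: $\mathcal{V}$ is a fixed congruence-modular variety of algebras (of a finite signature) that is semidegenerate: no nontrivial algebra in $\mathcal{V}$ has one-element subalgebras (equivalently, $\nabla_A$ is compact in $Con(A)$ for every $A\in\mathcal{V}$). For $A\in\mathcal{V}$, $Con(A)$ is the complete lattice of congruences of $A$, with least element $\Delta_A$ and greatest element $\nabla_A$; $K(A)$ is the set of compact (= finitely generated) congruences. Commutator: $[\cdot,\cdot]=[\cdot,\cdot]_A$ is the (modular) commutator, i.e. the greatest operation on the congruence lattices of members of $\mathcal{V}$ such that for every surjective morphism $f:A\to B$ in $\mathcal{V}$ and all $\alpha,\beta\in Con(A)$: $[\alpha,\beta]_A\subseteq\alpha\cap\beta$ and $[\alpha,\beta]_A\vee Ker(f)=f^{-1}([f(\alpha\vee Ker(f)),f(\beta\vee Ker(f))]_B)$. Residuation: $\alpha\rightarrow\beta=\bigvee\{\gamma\in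 Con(A)\mid[\alpha,\gamma]\subseteq\beta\}$. $\phi\in Con(A)\setminus\{\nabla_A\}$ is prime if $[\alpha,\beta]\subseteq\phi$ implies $\alpha\subseteq\phi$ or $\beta\subseteq\phi$ (for $\alpha,\beta\in Con(A)$); $Spec(A)$ is the set of prime congruences; $\rho(\theta)=\bigcap\{\phi\in Spec(A)\mid\theta\subseteq\phi\}$. $A$ is an $mp$-algebra if every prime congruence of $A$ contains a unique minimal prime congruence. A congruence $\theta$ of $A$ is $w$-pure (weakly pure) if for every $\alpha\in K(A)$, $\alpha\subseteq\theta$ implies $\theta\vee(\alpha\rightarrow\rho(\Delta_A))=\nabla_A$. *)

(* Defs.v *)
From mathcomp Require Import all_boot.
From mathcomp Require Import boolp classical_sets functions cardinality.

Set Implicit Arguments.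
Unset Strict Implicit.
Unset Printing Implicit Defensive.

Local Open Scope classical_set_scope.

(** * Algebras of a finite signature and varieties *)

Record signature := Signature { symb : finType; arity : symb -> nat }.

Record algebra (S : signature) := Algebra {
  carrier :> Type;
  op : forall f : symb S, ('I_(arity f) -> carrier) -> carrier;
  carrier_inhabited : inhabited carrier
}.
Arguments op {S} A f args : rename.

Inductive term (S : signature) :=
  | Var of nat
  | App (f : symb S) of ('I_(arity f) -> term S).

Fixpoint eval S (A : algebra S) (v : nat -> A) (t : term S) : A :=
  match t with
  | Var n => v n
  | App f ts => op A f (fun i => eval v (ts i))
  end.

Definition satisfies S (A : algebra S) (e : term S * term S) : Prop :=
  forall v : nat -> A, eval v e.1 = eval v e.2.

(* Terms over countably many variables suffice, operations being finitary. *)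
Definition is_variety S (V : set (algebra S)) : Prop :=
  exists E : set (term S * term S),
    V = [set A | forall e, E e -> satisfies A e].

Definition subuniverse S (A : algebra S) (B : set A) : Prop :=
  forall (f : symb S) (args : 'I_(arity f) -> A),
    (forall i, B (args i)) -> B (op A f args).

Definition nontrivial S (A : algebra S) : Prop := exists a b : A, a <> b.

Definition semidegenerate S (V : set (algebra S)) : Prop :=
  forall A, V A -> nontrivial A -> ~ exists a : A, subuniverse [set a].

Record hom S (A B : algebra S) := Hom {
  hom_fun :> A -> B;
  homP : forall f (args : 'I_(arity f) -> A),
    hom_fun (op A f args) = op B f (fun i => hom_fun (args i))
}.

Definition surjective_hom S (A B : algebra S) (f : hom A B) : Prop :=
  forall y : B, exists x : A, f x = y.

(** * Congruence lattices *)

(* Congruences are sets of pairs, ordered by inclusion; since all the laws are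
   propositions, equality of congruences is equality of sets ([con_eq]). *)
Record con S (A : algebra S) := Con {
  con_set :> set (A * A);
  con_refl : forall x, con_set (x, x);
  con_sym : forall x y, con_set (x, y) -> con_set (y, x);
  con_trans : forall x y z,
    con_set (x, y) -> con_set (y, z) -> con_set (x, z);
  con_op : forall f (u v : 'I_(arity f) -> A),
    (forall i, con_set (u i, v i)) -> con_set (op A f u, op A f v)
}.

Lemma con_eq S (A : algebra S) (alpha beta : con A) :
  alpha `<=` beta -> beta `<=` alpha -> alpha = beta.
Proof.
case: alpha beta => [r r1 r2 r3 r4] [s s1 s2 s3 s4] /= rs sr.
have E : r = s by apply/seteqP; split.
by subst s; congr Con; exact: Prop_irrelevance.
Qed.

Definition cnabla S (A : algebra S) : con A.
Proof. by exists setT. Defined.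

Definition cdelta S (A : algebra S) : con A.
Proof.
exists [set p | p.1 = p.2] => //= [x y z -> //|f u v uv].
by congr op; apply/funext.
Defined.

Definition cmeets S (A : algebra S) (F : set (con A)) : con A.
Proof.
exists (\bigcap_(gamma in F) (gamma : set (A * A))).
- by move=> x g _; exact: con_refl.
- by move=> x y h g Fg; exact/con_sym/h.
- by move=> x y z h k g Fg; exact: con_trans (h g Fg) (k g Fg).
- by move=> f u v h g Fg; apply: con_op => i; exact: h.
Defined.

(* the congruence generated by a set of pairs *)
Definition cgen S (A : algebra S) (R : set (A * A)) : con A :=
  cmeets [set gamma : con A | R `<=` gamma].

Definition cjoins S (A : algebra S) (F : set (con A)) : con A :=
  cgen (\bigcup_(gamma in F) (gamma : set (A * A))).

Definition cmeet S (A : algebra S) (alpha beta : con A) : con A :=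
  cmeets [set alpha; beta].

Definition cjoin S (A : algebra S) (alpha beta : con A) : con A :=
  cjoins [set alpha; beta].

Definition compact_con S (A : algebra S) : set (con A) :=
  [set alpha | forall F : set (con A), alpha `<=` cjoins F ->
     exists G : set (con A), [/\ finite_set G, G `<=` F & alpha `<=` cjoins G]].

Definition congruence_modular S (V : set (algebra S)) : Prop :=
  forall A, V A -> forall alpha beta gamma : con A, alpha `<=` gamma ->
    cjoin alpha (cmeet beta gamma) = cmeet (cjoin alpha beta) gamma.

Definition cpreim S (A B : algebra S) (f : hom A B) (theta : con B) : con A.
Proof.
exists [set p | con_set theta (f p.1, f p.2)] => /=.
- by move=> x; exact: con_refl.
- by move=> x y; exact: con_sym.
- by move=> x y z; exact: con_trans.
- by move=> g u v h; rewrite !homP; exact: con_op.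
Defined.

Definition cker S (A B : algebra S) (f : hom A B) : con A :=
  cpreim f (cdelta B).

(* For f surjective and Ker f included in theta, this is the plain set-theoretic
   image of theta ([cimageE]); this is the only case in which it is used. *)
Definition cimage S (A B : algebra S) (f : hom A B) (theta : con A) : con B :=
  cgen [set (f p.1, f p.2) | p in (theta : set (A * A))].

(** * The modular commutator *)

Definition commutator_law S (V : set (algebra S))
    (c : forall A : algebra S, con A -> con A -> con A) : Prop :=
  (forall A, V A -> forall alpha beta : con A,
     c A alpha beta `<=` alpha `&` beta) /\
  (forall A B (f : hom A B), V A -> V B -> surjective_hom f ->
     forall alpha beta : con A,
       cjoin (c A alpha beta) (cker f) =
       cpreim f (c B (cimage f (cjoin alpha (cker f)))
                     (cimage f (cjoin beta (cker f))))).

(* The greatest operation satisfying [commutator_law], obtained as the pointwise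
   join of all of them; see [commutator_lawP] and [commutator_max]. *)
Definition commutator S (V : set (algebra S)) (A : algebra S)
    (alpha beta : con A) : con A :=
  cjoins [set gamma | exists2 c, commutator_law V c & gamma = c A alpha beta].

Definition resid S (V : set (algebra S)) (A : algebra S)
    (alpha beta : con A) : con A :=
  cjoins [set gamma | commutator V alpha gamma `<=` beta].

(** * Prime congruences, radicals, mp-algebras, w-pure congruences *)

Definition Spec S (V : set (algebra S)) (A : algebra S) : set (con A) :=
  [set phi | phi <> cnabla A /\
     forall alpha beta : con A, commutator V alpha beta `<=` phi ->
       alpha `<=` phi \/ beta `<=` phi].

Definition radical S (V : set (algebra S)) (A : algebra S) (theta : con A) :
    con A :=
  cmeets [set phi | Spec V phi /\ theta `<=` phi].

Definition minimal_prime S (V : set (algebra S)) (A : algebra S) :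
    set (con A) :=
  [set psi | Spec V psi /\
     forall chi : con A, Spec V chi -> chi `<=` psi -> chi = psi].

Definition mp_algebra S (V : set (algebra S)) (A : algebra S) : Prop :=
  forall phi : con A, Spec V phi ->
    exists! psi : con A, minimal_prime V psi /\ psi `<=` phi.

Definition w_pure S (V : set (algebra S)) (A : algebra S) (theta : con A) :
    Prop :=
  forall alpha : con A, compact_con alpha -> alpha `<=` theta ->
    cjoin theta (resid V alpha (radical V (cdelta A))) = cnabla A.

(** * Adequacy of [cimage] and [commutator] *)

Lemma cgen_sub S (A : algebra S) (R : set (A * A)) : R `<=` cgen R.
Proof. by move=> p Rp g Rg; exact: Rg. Qed.

Lemma cgen_min S (A : algebra S) (R : set (A * A)) (theta : con A) :
  R `<=` theta -> cgen R `<=` theta.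
Proof. by move=> h p; exact. Qed.

Lemma cjoins_ub S (A : algebra S) (F : set (con A)) (alpha : con A) :
  F alpha -> alpha `<=` cjoins F.
Proof. by move=> Fa p ap; apply: cgen_sub; exists alpha. Qed.

Lemma cjoins_le S (A : algebra S) (F : set (con A)) (theta : con A) :
  (forall alpha, F alpha -> alpha `<=` theta) -> cjoins F `<=` theta.
Proof. by move=> h; apply: cgen_min => p [g Fg gp]; exact: h gp. Qed.

Lemma cjoin_le S (A : algebra S) (alpha beta theta : con A) :
  alpha `<=` theta -> beta `<=` theta -> cjoin alpha beta `<=` theta.
Proof. by move=> h k; apply: cjoins_le => g [] ->. Qed.

Lemma cjoin_l S (A : algebra S) (alpha beta : con A) :
  alpha `<=` cjoin alpha beta.
Proof. by apply: cjoins_ub; left. Qed.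

Lemma cjoin_r S (A : algebra S) (alpha beta : con A) :
  beta `<=` cjoin alpha beta.
Proof. by apply: cjoins_ub; right. Qed.

Lemma cimageE S (A B : algebra S) (f : hom A B) (theta : con A) :
  surjective_hom f -> cker f `<=` theta ->
  cimage f theta = [set (f p.1, f p.2) | p in (theta : set (A * A))] :> set _.
Proof.
move=> sf kf; set R := [set _ | _ in _].
have RE x y : R (f x, f y) -> con_set theta (x, y).
  case=> -[a b] /= ab [fa fb].
  apply: con_trans (kf (x, a) _) (con_trans ab (kf (b, y) _)) => //=.
have [g fg] := @choice _ _ (fun y x => f x = y) sf.
have RI x y : con_set theta (x, y) -> R (f x, f y) by exists (x, y).
have RP x y : R (x, y) <-> con_set theta (g x, g y).
  by split=> [h|/RI]; [apply: RE; rewrite !fg|rewrite !fg].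
have R1 x : R (x, x) by apply/RP/con_refl.
have R2 x y : R (x, y) -> R (y, x) by move=> /RP h; exact/RP/con_sym.
have R3 x y z : R (x, y) -> R (y, z) -> R (x, z).
  by move=> /RP h /RP k; apply/RP; exact: con_trans h k.
have R4 h (u v : 'I_(arity h) -> B) :
    (forall i, R (u i, v i)) -> R (op B h u, op B h v).
  move=> uv; have E w : op B h w = f (op A h (fun i => g (w i))).
    by rewrite homP; congr op; apply/funext => i; rewrite fg.
  by rewrite !E; apply/RI/con_op => i; exact/RP.
apply/seteqP; split; last exact: cgen_sub.
exact: (@cgen_min _ _ _ (Con R1 R2 R3 R4)).
Qed.

Lemma commutator_max S (V : set (algebra S))
    (c : forall A : algebra S, con A -> con A -> con A) :
  commutator_law V c -> forall (A : algebra S) (alpha beta : con A),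
    c A alpha beta `<=` commutator V alpha beta.
Proof. by move=> cV A a b; apply: cjoins_ub; exists c. Qed.

Lemma commutator_lawP S (V : set (algebra S)) :
  commutator_law V (@commutator S V).
Proof.
split=> [A VA a b|A B f VA VB sf a b].
  suff h : commutator V a b `<=` cmeet a b.
    by move=> p /h abp; split; apply: abp; [left|right].
  by apply: cjoins_le => _ [c [c1 _] ->] p /(c1 A VA)[ap bp] g [] ->.
set K := cker f; set a' := cimage _ _; set b' := cimage _ _.
have Kp th : K `<=` cpreim f th.
  by case=> x y /= ->; exact: con_refl.
apply: con_eq.
  apply: cjoin_le; last exact: Kp.
  apply: cjoins_le => _ [c cV ->] p cp.
  apply: (commutator_max cV (A := B)).
  have : con_set (cjoin (c A a b) K) p by exact: cjoin_l.
  by rewrite (cV.2 A B f VA VB sf a b).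
set L := cjoin _ K; have KL : K `<=` L by exact: cjoin_r.
suff h : commutator V a' b' `<=` cimage f L.
  case=> x y /h; rewrite (cimageE sf KL) => -[[s t] /= st [fs ft]].
  have xs : con_set L (x, s) by exact: KL.
  have ty : con_set L (t, y) by exact: KL.
  by apply: (@con_trans _ _ L x s y xs); exact: (@con_trans _ _ L s t y st ty).
apply: cjoins_le => _ [c cV ->] [u v].
have [x <-] := sf u; have [y <-] := sf v => cxy.
apply: cgen_sub; exists (x, y) => //.
have : con_set (cpreim f (c B a' b')) (x, y) by [].
rewrite -(cV.2 A B f VA VB sf a b); apply: cjoin_le KL (x, y) => p cp.
by apply: cjoin_l; exact: commutator_max cp.
Qed.

(* Main.v *)
Require Import Defs.
From mathcomp Require Import all_boot.
From mathcomp Require Import boolp classical_sets functions cardinality.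

Local Open Scope classical_set_scope.

(** The theorem is a statement about the multiplicative lattice formed by the
    congruences of A under the commutator, so the work is to establish that
    the greatest operation satisfying the homomorphism law has the expected
    algebraic properties, and then to run an argument of commutative ring
    theory.

    The commutator.  Call alpha central over beta modulo delta when every
    2 x 2 matrix with rows in alpha and columns in beta, generated by the
    constant-row and constant-column ones, has its second row in delta as soon
    as its first row is ([centralizes]).  On the algebra of alpha-related
    pairs, let D be the congruence generated by identifying the diagonal
    pairs (x, x) and (u, u) with (x, u) in beta.  By the shifting lemma, a
    direct consequence of the modular law, centrality says exactly that D
    meets the kernel of the first projection below the preimage of delta under
    the second one ([centralizes_sub]).  In this form it is visibly preserved
    when delta grows; a second use of the shifting lemma makes it symmetric in
    alpha and beta, and hence compatible with joins on both sides.  The least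
    delta therefore satisfies the homomorphism law ([tc_commutator_law]).
    Conversely, applying the law to the second projection, with D and the
    kernel of the first projection as arguments, bounds every operation
    obeying it ([law_le_centralizes]).  So [alpha, beta] is below delta if and
    only if alpha centralizes beta modulo delta ([commutator_le]), and
    monotonicity, symmetry, complete distributivity over joins and the
    residuation law follow.

    Semidegeneracy.  A congruence one of whose classes is a subalgebra gives a
    quotient with a one-element subalgebra, hence is full
    ([semidegenerate_full]).  Applied to A itself, this shows that nabla is
    generated by the finitely many pairs (f(a, ..., a), a), hence is compact;
    applied to D for beta = nabla, whose diagonal is contained in one class, it
    shows gamma = [gamma, nabla].

    Primes.  Write rho for the radical of the least congruence and alpha' for
    alpha -> rho.  Since compact congruences are closed under the commutator,
    Zorn's lemma separates multiplicatively closed sets of compact congruences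
    from congruences by primes ([prime_avoiding]).  This yields primes above
    proper congruences, and, when alpha' is below a prime phi, a prime below
    phi that omits alpha ([prime_below_omitting]).

    Now (1) gives (2): if [alpha, beta] lies below rho and the join of alpha'
    and beta' is proper, it lies below some prime phi, whose unique minimal
    prime can contain neither alpha nor beta.  Conversely, if psi and chi are
    distinct minimal primes below phi, take a compact alpha below psi but not
    below chi; alpha' is not below psi, and a compact beta below alpha' but
    not below psi has beta' below psi, while alpha' is below chi, so that the
    join of alpha' and beta' is below phi.  For (3) from (2), a compact gamma
    with [[alpha, beta], gamma] below rho makes [alpha, gamma]' and
    [beta, gamma]' comaximal, and multiplying their join by gamma gives
    gamma = [gamma, nabla] below the join of alpha' and beta'.  Finally (4) is
    a restatement of (2) by residuation. *)
Set Implicit Arguments.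
Unset Strict Implicit.
Unset Printing Implicit Defensive.

(** * Homomorphisms, subdirect products and quotients *)

Lemma eval_hom S (A B : algebra S) (h : hom A B) (v : nat -> A) (t : term S) :
  h (eval v t) = eval (fun n => h (v n)) t.
Proof.
elim: t => [n|f ts IH] //=.
by rewrite homP; congr op; apply/funext => i; exact: IH.
Qed.

Lemma variety_subdirect S (V : set (algebra S)) (A B : algebra S)
    (p q : hom B A) :
  is_variety V -> V A -> (forall x y, p x = p y -> q x = q y -> x = y) -> V B.
Proof.
case=> E -> VA inj e Ee v.
by apply: inj; rewrite !eval_hom; exact: VA.
Qed.

Lemma variety_image S (V : set (algebra S)) (A B : algebra S) (f : hom A B) :
  is_variety V -> V A -> surjective_hom f -> V B.
Proof.
case=> E -> VA sf e Ee v.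
have [g fg] := @choice _ _ (fun y x => f x = y) sf.
have -> : v = (fun n => f (g (v n))) by apply/funext => n; rewrite fg.
by rewrite -!eval_hom (VA e Ee).
Qed.

(** The quotient is realized on the fixed points of a choice of representatives
    that is constant on the classes of theta. *)
Lemma quotient_exists S (A : algebra S) (theta : con A) :
  exists (B : algebra S) (f : hom A B), surjective_hom f /\
    forall x y, f x = f y <-> con_set theta (x, y).
Proof.
have [a0] := carrier_inhabited A.
have /choice[pick pickP] : forall C : set A, exists y, C !=set0 -> C y.
  move=> C; have [[y Cy]|nC] := pselect (C !=set0); first by exists y.
  by exists a0.
pose rep x := pick [set y | con_set theta (x, y)].
have repP x : con_set theta (x, rep x).
  by apply: (pickP [set y | con_set theta (x, y)]); exists x; exact: con_refl.
have repE x y : rep x = rep y <-> con_set theta (x, y).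
  split=> [xy|xy].
    by apply: con_trans (repP x) _; rewrite xy; exact/con_sym/repP.
  congr pick; apply/seteqP; split=> z /= h; last exact: con_trans xy h.
  by apply: con_trans h; exact: con_sym.
have rep_id x : rep (rep x) = rep x by apply/repE/con_sym/repP.
pose Q := {x : A | rep x = x}; pose cl x : Q := exist _ (rep x) (rep_id x).
have clE x y : cl x = cl y <-> con_set theta (x, y).
  rewrite -repE; split=> [[]//|xy].
  rewrite /cl; move: (rep_id x) (rep_id y); rewrite xy => e e'.
  by congr exist; exact: Prop_irrelevance.
pose B := @Algebra S Q (fun f u => cl (op A f (fun i => sval (u i))))
  (inhabits (cl a0)).
have clH f (u : 'I_(arity f) -> A) :
    (cl (op A f u) : B) = op B f (fun i => cl (u i)).
  by apply/clE/con_op => i /=; exact: repP.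
exists B, (Hom clH); split=> // -[y ry]; exists y.
rewrite /= /cl; move: (rep_id y); rewrite ry => e.
by congr exist; exact: Prop_irrelevance.
Qed.

(** The hypothesis says that the theta-class of a is a subalgebra, so that it
    becomes a one-element subalgebra of the quotient by theta. *)
Lemma semidegenerate_full S (V : set (algebra S)) (A : algebra S)
    (theta : con A) (a : A) :
  is_variety V -> semidegenerate V -> V A ->
  (forall f, con_set theta (op A f (fun=> a), a)) ->
  forall x y, con_set theta (x, y).
Proof.
move=> varV semiV VA ha x y.
have [B [f [sf fE]]] := quotient_exists theta.
apply: (fE x y).1; apply: contrapT => fxy.
apply: (semiV B (variety_image varV VA sf)); first by exists (f x), (f y).
exists (f a) => g u ua /=.
have -> : u = (fun i => f a) by apply/funext.
by rewrite -homP; apply: (fE _ _).2; exact: ha.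
Qed.

(** * Joins of congruences *)

(** Generating sets of this kind, contrary to arbitrary sets of pairs, yield the
    congruence they generate by mere transitive closure. *)
Definition tolerance S (A : algebra S) (R : set (A * A)) : Prop :=
  [/\ forall x, R (x, x), forall x y, R (x, y) -> R (y, x) &
      forall f (u v : 'I_(arity f) -> A),
        (forall i, R (u i, v i)) -> R (op A f u, op A f v)].

Lemma con_tolerance S (A : algebra S) (theta : con A) : tolerance theta.
Proof. by split; [exact: con_refl|exact: con_sym|exact: con_op]. Qed.

Fixpoint compose A I (T : I -> set (A * A)) (w : seq I) : set (A * A) :=
  if w is i :: w' then
    [set p | exists2 z, T i (p.1, z) & compose T w' (z, p.2)]
  else [set p | p.1 = p.2].

(** The congruence generated by tolerances is the union of their finite
    composites, so that it stays inside any preorder E containing them, even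
    when E is not compatible with the operations. *)
Lemma cgen_tolerances S (A : algebra S) I (T : I -> set (A * A))
    (E : set (A * A)) :
  (forall i, tolerance (T i)) -> (forall i, T i `<=` E) ->
  (forall x, E (x, x)) ->
  (forall x y z, E (x, y) -> E (y, z) -> E (x, z)) ->
  cgen (\bigcup_(i in setT) T i) `<=` E.
Proof.
move=> tolT TE E1 E3.
pose K := [set p : A * A | exists w, compose T w p].
have K0 w x : compose T w (x, x).
  elim: w => //= i w IH; exists x => //.
  by case: (tolT i).
have Kcat w w' x y z :
    compose T w (x, y) -> compose T w' (y, z) -> compose T (w ++ w') (x, z).
  elim: w x => [x /= ->//|i w IH x /= [t Tt wt] w'z].
  by exists t => //; exact: IH.
have K1 x : K (x, x) by exists [::].
have K3 x y z : K (x, y) -> K (y, z) -> K (x, z).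
  by case=> w wxy [w' wyz]; exists (w ++ w'); exact: Kcat wxy wyz.
have K2 x y : K (x, y) -> K (y, x).
  case=> w; elim: w x => [x /= ->//|i w IH x /= [t Txt /IH Kyt]].
  apply: K3 Kyt _; exists [:: i] => /=; exists x => //.
  by have [_ h _] := tolT i; exact: h.
have Kop w f (u v : 'I_(arity f) -> A) :
    (forall i, compose T w (u i, v i)) -> compose T w (op A f u, op A f v).
  elim: w u => [u uv /=|j w IH u uv /=].
    by congr op; apply/funext.
  have /choice[t ut] : forall i, exists z, T j (u i, z) /\ compose T w (z, v i).
    by move=> i; have [z] := uv i; exists z.
  exists (op A f t); last by apply: IH => i; case: (ut i).
  by have [_ _ h] := tolT j; apply: h => i; case: (ut i).
have K4 f (u v : 'I_(arity f) -> A) :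
    (forall i, K (u i, v i)) -> K (op A f u, op A f v).
  move=> /choice[w uv].
  exists (flatten [seq w i | i <- enum 'I_(arity f)]); apply: Kop => i.
  (* padding with reflexive steps makes all argument chains equally long *)
  have : i \in enum 'I_(arity f) by rewrite mem_enum.
  elim: (enum _) => //= j s IH; rewrite inE => /orP[/eqP<-|/IH].
    exact: Kcat (uv i) (K0 _ _).
  exact: Kcat (K0 _ _).
apply: (@subset_trans _ K).
  apply: (@cgen_min _ _ _ (Con K1 K2 K3 K4)) => -[x y] [i _ Txy].
  by exists [:: i]; exists y.
case=> x y [w]; elim: w x => [x /= ->//|i w IH x /= [t /TE Ext /IH]].
exact: E3.
Qed.

Lemma cjoins_sub S (A : algebra S) (F : set (con A)) (E : set (A * A)) :
  (forall theta, F theta -> theta `<=` E) ->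
  (forall x, E (x, x)) ->
  (forall x y z, E (x, y) -> E (y, z) -> E (x, z)) ->
  cjoins F `<=` E.
Proof.
move=> FE E1 E3.
apply: (@subset_trans _
  (cgen (\bigcup_(i in setT) (sval (i : {theta | F theta}) : set (A * A))))).
  apply: cjoins_le => theta Ft p tp; apply: cgen_sub.
  by exists (exist _ theta Ft).
apply: cgen_tolerances => // [i|[theta /= Ft]]; first exact: con_tolerance.
exact: FE.
Qed.

(** * The shifting lemma *)

(** In a modular lattice, beta meets alpha \/ (beta /\ gamma) exactly in
    (alpha /\ beta) \/ (beta /\ gamma), which lies below gamma; and the pair
    (u, v) is reached from (x, y) through two alpha steps. *)
Lemma shifting S (V : set (algebra S)) (A : algebra S)
    (alpha beta gamma : con A) (x y u v : A) :
  congruence_modular V -> V A ->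
  (forall s t, con_set alpha (s, t) -> con_set beta (s, t) ->
     con_set gamma (s, t)) ->
  con_set alpha (x, u) -> con_set alpha (y, v) ->
  con_set beta (x, y) -> con_set beta (u, v) ->
  con_set gamma (x, y) -> con_set gamma (u, v).
Proof.
move=> modV VA abg xu yv xy uv gxy.
have bgb : cmeet beta gamma `<=` beta by move=> p h; apply: h; left.
have := modV A VA _ alpha _ bgb => E.
have : con_set (cmeet (cjoin (cmeet beta gamma) alpha) beta) (u, v).
  move=> _ [->|->] //.
  apply: (@con_trans _ _ _ _ x); first by apply: cjoin_r; exact: con_sym.
  apply: (@con_trans _ _ _ _ y); last exact: cjoin_r.
  by apply: cjoin_l => _ [->|->].
rewrite -E; apply: cjoin_le => [p h|[s t] h]; first by apply: h; right.
by apply: abg; apply: h; [left|right].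
Qed.

(** * The algebra of alpha-related pairs *)

Lemma pair_alg_op S (A : algebra S) (alpha : con A) f
    (u : 'I_(arity f) -> {p : A * A | con_set alpha p}) :
  con_set alpha (op A f (fun i => (sval (u i)).1),
                 op A f (fun i => (sval (u i)).2)).
Proof. by apply: con_op => i; case: (u i) => -[]. Qed.

Lemma pair_alg_inhabited S (A : algebra S) (alpha : con A) :
  inhabited {p : A * A | con_set alpha p}.
Proof.
by have [a] := carrier_inhabited A; exists; exists (a, a); exact: con_refl.
Qed.

Definition pair_alg S (A : algebra S) (alpha : con A) : algebra S :=
  @Algebra S {p : A * A | con_set alpha p}
    (fun f u => exist _ _ (pair_alg_op u)) (pair_alg_inhabited alpha).

Definition pairof S (A : algebra S) (alpha : con A) (x y : A)
    (xy : con_set alpha (x, y)) : pair_alg alpha := exist _ (x, y) xy.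

Definition fst_hom S (A : algebra S) (alpha : con A) : hom (pair_alg alpha) A.
Proof. by exists (fun p => (sval p).1). Defined.

Definition snd_hom S (A : algebra S) (alpha : con A) : hom (pair_alg alpha) A.
Proof. by exists (fun p => (sval p).2). Defined.

Lemma pair_alg_inj S (A : algebra S) (alpha : con A) (p q : pair_alg alpha) :
  fst_hom alpha p = fst_hom alpha q -> snd_hom alpha p = snd_hom alpha q ->
  p = q.
Proof.
case: p q => [[x y] xy] [[u v] uv] /= xu yv; subst u v.
by congr exist; exact: Prop_irrelevance.
Qed.

Lemma pair_alg_variety S (V : set (algebra S)) (A : algebra S) (alpha : con A) :
  is_variety V -> V A -> V (pair_alg alpha).
Proof.
by move=> varV VA; exact: variety_subdirect varV VA (@pair_alg_inj _ _ alpha).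
Qed.

Definition diag_hom S (A : algebra S) (alpha : con A) : hom A (pair_alg alpha).
Proof.
exists (fun x => pairof (con_refl alpha x)) => f u.
exact: pair_alg_inj.
Defined.

Lemma snd_hom_surj S (A : algebra S) (alpha : con A) :
  surjective_hom (snd_hom alpha).
Proof. by move=> x; exists (diag_hom alpha x). Qed.

(** * Centrality *)

(** The subalgebra of the fourth power of A whose elements are the matrices
    with rows (x, y) and (u, v), the rows being related by alpha and the
    columns by beta. *)
Inductive matrix S (A : algebra S) (alpha beta : con A) :
    A -> A -> A -> A -> Prop :=
  | MatrixRow x y of con_set alpha (x, y) : matrix alpha beta x y x y
  | MatrixCol x u of con_set beta (x, u) : matrix alpha beta x x u u
  | MatrixOp f (x y u v : 'I_(arity f) -> A) of
      (forall i, matrix alpha beta (x i) (y i) (u i) (v i)) :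
      matrix alpha beta (op A f x) (op A f y) (op A f u) (op A f v).

(** The term condition: alpha centralizes beta modulo delta. *)
Definition centralizes S (A : algebra S) (alpha beta delta : con A) : Prop :=
  forall x y u v, matrix alpha beta x y u v ->
    con_set delta (x, y) -> con_set delta (u, v).

(** Its generators are the pairs of diagonal elements whose entries are related
    by beta; it is also the transitive closure of [matrix], viewed as a
    relation between rows. *)
Definition diag_con S (A : algebra S) (alpha beta : con A) :
  con (pair_alg alpha) := cimage (diag_hom alpha) beta.

Lemma matrix_tr S (A : algebra S) (alpha beta : con A) x y u v :
  matrix alpha beta x y u v -> matrix beta alpha x u y v.
Proof.
by elim=> *; [exact: MatrixCol|exact: MatrixRow|exact: MatrixOp].
Qed.

Lemma matrix_sym S (A : algebra S) (alpha beta : con A) x y u v :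
  matrix alpha beta x y u v -> matrix alpha beta u v x y.
Proof.
elim=> [s t h|s t h|*]; [exact: MatrixRow| |exact: MatrixOp].
by apply: MatrixCol; exact: con_sym.
Qed.

Lemma matrix_le S (A : algebra S) (alpha beta alpha' beta' : con A) x y u v :
  alpha `<=` alpha' -> beta `<=` beta' ->
  matrix alpha beta x y u v -> matrix alpha' beta' x y u v.
Proof.
move=> aa bb; elim=> [s t /aa|s t /bb|*];
  [exact: MatrixRow|exact: MatrixCol|exact: MatrixOp].
Qed.

Lemma matrix_row S (A : algebra S) (alpha beta : con A) x y u v :
  matrix alpha beta x y u v -> con_set alpha (x, y).
Proof. by elim=> // *; [exact: con_refl|exact: con_op]. Qed.

Lemma matrix_row' S (A : algebra S) (alpha beta : con A) x y u v :
  matrix alpha beta x y u v -> con_set alpha (u, v).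
Proof. by move/matrix_sym/matrix_row. Qed.

Lemma matrix_hom S (A B : algebra S) (f : hom A B) (alpha beta : con A)
    (alpha' beta' : con B) x y u v :
  alpha `<=` cpreim f alpha' -> beta `<=` cpreim f beta' ->
  matrix alpha beta x y u v -> matrix alpha' beta' (f x) (f y) (f u) (f v).
Proof.
move=> aa bb; elim=> [s t /aa h|s t /bb h|g a b c d _ IH].
- exact: MatrixRow.
- exact: MatrixCol.
by rewrite !homP; exact: MatrixOp.
Qed.

Lemma matrix_lift S (A B : algebra S) (f : hom A B) (alpha beta : con A)
    x y u v :
  surjective_hom f -> cker f `<=` alpha -> cker f `<=` beta ->
  matrix (cimage f alpha) (cimage f beta) x y u v ->
  exists a b c d, [/\ f a = x, f b = y, f c = u, f d = v &
                      matrix alpha beta a b c d].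
Proof.
move=> sf ka kb; elim=> [s t|s t|g a b c d _ IH].
- rewrite cimageE // => -[[p q] /= pq [fp fq]].
  by exists p, q, p, q; split=> //; exact: MatrixRow.
- rewrite cimageE // => -[[p q] /= pq [fp fq]].
  by exists p, p, q, q; split=> //; exact: MatrixCol.
- have /choice[a' /choice[b' /choice[c' /choice[d' h]]]] := IH.
  exists (op A g a'), (op A g b'), (op A g c'), (op A g d').
  split; [| | | |by apply: MatrixOp => i; case: (h i)];
    by rewrite homP; congr op; apply/funext => i; case: (h i).
Qed.

Lemma matrix_diag_con S (A : algebra S) (alpha beta : con A) x y u v
    (xy : con_set alpha (x, y)) (uv : con_set alpha (u, v)) :
  matrix alpha beta x y u v ->
  con_set (diag_con alpha beta) (pairof xy, pairof uv).
Proof.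
move=> m; elim: m xy uv => [s t h|s t h|f a b c d m IH] xy uv.
- by rewrite (Prop_irrelevance xy uv); exact: con_refl.
- apply: cgen_sub; exists (s, t) => //=.
  by congr pair; exact: pair_alg_inj.
- pose p i := pairof (matrix_row (m i)); pose q i := pairof (matrix_row' (m i)).
  have -> : pairof xy = op (pair_alg alpha) f p by exact: pair_alg_inj.
  have -> : pairof uv = op (pair_alg alpha) f q by exact: pair_alg_inj.
  by apply: con_op => i; exact: IH.
Qed.

(** Since [matrix] is a tolerance on the algebra of rows, what it preserves is
    also preserved by the congruence it generates. *)
Lemma centralizes_diag S (A : algebra S) (alpha beta delta : con A) :
  centralizes alpha beta delta ->
  diag_con alpha beta `<=`
    [set pq | con_set delta (sval pq.1) <-> con_set delta (sval pq.2)].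
Proof.
move=> Z.
pose T (_ : unit) := [set pq : pair_alg alpha * pair_alg alpha |
  matrix alpha beta (sval pq.1).1 (sval pq.1).2 (sval pq.2).1 (sval pq.2).2].
apply: (@subset_trans _ (cgen (\bigcup_(i in setT) T i))).
  apply: cgen_min => _ [[x u] xu <-]; apply: cgen_sub.
  by exists tt => //; exact: MatrixCol.
apply: cgen_tolerances => [[]|[]|//|p q r]; last exact: iff_trans.
- split=> [[[x y] h]|x y|f u v h]; [exact: MatrixRow|exact: matrix_sym|].
  exact: MatrixOp.
- case=> -[[x y] xy] [[u v] uv] m /=; split; first exact: Z m.
  exact: Z (matrix_sym m).
Qed.

(** Centrality as an inequality between congruences of the algebra of pairs:
    the meet of D with the kernel of the first projection lies below the
    preimage of delta.  Any D-pair of rows can be moved, along the kernel of the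
    second projection, to one that starts on the diagonal, where the term
    condition applies; and the inequality is exactly the hypothesis of the
    shifting lemma needed to recover the term condition. *)
Lemma centralizes_sub S (V : set (algebra S)) (A : algebra S)
    (alpha beta delta : con A) :
  is_variety V -> congruence_modular V -> V A ->
  centralizes alpha beta delta <->
  forall p q : pair_alg alpha, (sval p).1 = (sval q).1 ->
    con_set (diag_con alpha beta) (p, q) ->
    con_set delta ((sval p).2, (sval q).2).
Proof.
move=> varV modV VA.
have VR := pair_alg_variety alpha varV VA.
split=> [Z|H x y u v m xy].
  move=> [[x y] xy] [[x' v] xv] xx.
  have {}xx : x = x' := xx; subst x' => D; rewrite /sval /=.
  have yv : con_set alpha (y, v) by apply: con_trans (con_sym xy) xv.
  have Dyv : con_set (diag_con alpha beta)
      (pairof (con_refl alpha y), pairof yv).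
    apply: (@shifting _ _ _ (cker (snd_hom alpha)) (cker (fst_hom alpha))
      (diag_con alpha beta) _ _ _ _ modV VR _ _ _ _ _ D) => // s t h1 h2.
    by have -> : s = t by [exact: pair_alg_inj h2 h1]; exact: con_refl.
  by have /= [h _] := centralizes_diag Z Dyv; apply: h; exact: con_refl.
have xu : con_set beta (x, u) by exact: matrix_row (matrix_tr m).
have xya := matrix_row m; have uva := matrix_row' m.
have D1 := matrix_diag_con (con_refl alpha x) (con_refl alpha u)
  (MatrixCol alpha xu).
have D2 := matrix_diag_con xya uva m.
apply: (@shifting _ _ _ (diag_con alpha beta) (cker (fst_hom alpha))
  (cpreim (snd_hom alpha) delta) _ _ _ _ modV VR _ D1 D2) => //= s t h1 h2.
exact: H.
Qed.

Section Centrality.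
Context S (V : set (algebra S)) (varV : is_variety V)
  (modV : congruence_modular V) (A : algebra S) (VA : V A).
Implicit Types alpha beta delta : con A.

Lemma centralizes_up alpha beta delta delta' :
  delta `<=` delta' -> centralizes alpha beta delta ->
  centralizes alpha beta delta'.
Proof.
move=> dd /(centralizes_sub _ _ _ varV modV VA) H.
by apply/(centralizes_sub _ _ _ varV modV VA) => p q h D; exact/dd/H.
Qed.

(** For a matrix with rows (x, y) in beta and (u, v), D relates (x, x) to (y, y)
    and (x, u) to (y, v), while the kernel of the first projection relates
    (x, x) to (x, u) and (y, y) to (y, v).  Shifting the preimage of delta under
    the second projection along that kernel turns (x, y) in delta into (u, v) in
    delta. *)
Lemma centralizes_sym alpha beta delta :
  centralizes alpha beta delta -> centralizes beta alpha delta.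
Proof.
move=> Z x y u v m xy; have m' := matrix_tr m.
have VR := pair_alg_variety alpha varV VA.
have xua := matrix_row m'; have yva := matrix_row' m'.
have D1 := matrix_diag_con (con_refl alpha x) (con_refl alpha y)
  (MatrixCol alpha (matrix_row m)).
have D2 := matrix_diag_con xua yva m'.
apply: (@shifting _ _ _ (cker (fst_hom alpha)) (diag_con alpha beta)
  (cpreim (snd_hom alpha) delta) _ _ _ _ modV VR _ _ _ D1 D2) => //= s t h1 h2.
exact: (centralizes_sub _ _ _ varV modV VA).1 h2.
Qed.

(** With alpha fixed, belonging to delta is invariant under each of the
    congruences D, hence under their join, and the pairs of A whose diagonals
    are identified by that join form a congruence. *)
Lemma centralizes_joins alpha (F : set (con A)) delta :
  (forall beta, F beta -> centralizes alpha beta delta) ->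
  centralizes alpha (cjoins F) delta.
Proof.
move=> ZF.
(* all these congruences live on the algebra of alpha-related pairs, which does
   not depend on beta *)
pose J := cjoins [set diag_con alpha beta | beta in F].
have JE : J `<=`
    [set pq | con_set delta (sval pq.1) <-> con_set delta (sval pq.2)].
  apply: cjoins_sub => [_ [beta Fb <-]|//|p q r]; last exact: iff_trans.
  exact: centralizes_diag (ZF _ Fb).
have FJ : cjoins F `<=` cpreim (diag_hom alpha) J.
  apply: cjoins_le => beta Fb -[x u] xu.
  apply: (@cjoins_ub _ _ _ (diag_con alpha beta)); first by exists beta.
  by apply: cgen_sub; exists (x, u).
move=> x y u v m.
have DJ : diag_con alpha (cjoins F) `<=` J.
  by apply: cgen_min => _ [[a b] /FJ ab <-].
by have [] := JE _ (DJ _ (matrix_diag_con (matrix_row m) (matrix_row' m) m)).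
Qed.

Lemma centralizes_join alpha beta beta' delta :
  centralizes alpha beta delta -> centralizes alpha beta' delta ->
  centralizes alpha (cjoin beta beta') delta.
Proof. by move=> Z Z'; apply: centralizes_joins => _ [] ->. Qed.

Lemma centralizes_le alpha beta alpha' beta' delta :
  alpha `<=` alpha' -> beta `<=` beta' ->
  centralizes alpha' beta' delta -> centralizes alpha beta delta.
Proof. by move=> aa bb Z x y u v /(matrix_le aa bb); exact: Z. Qed.

Lemma centralizes_self_l alpha beta : centralizes alpha beta alpha.
Proof. by move=> x y u v /matrix_row'. Qed.

Lemma centralizes_self_r alpha beta delta :
  beta `<=` delta -> centralizes alpha beta delta.
Proof.
by move=> bd; apply/(centralizes_up bd)/centralizes_sym/centralizes_self_l.
Qed.

End Centrality.

(** The commutator defined by the term condition; it will turn out to be the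
    greatest operation obeying [commutator_law]. *)
Definition tc_commutator S (A : algebra S) (alpha beta : con A) : con A :=
  cmeets [set delta | centralizes alpha beta delta].

Lemma tc_commutator_centralizes S (A : algebra S) (alpha beta : con A) :
  centralizes alpha beta (tc_commutator alpha beta).
Proof. by move=> x y u v m h d Z; exact: Z m (h d Z). Qed.

(** If delta contains the kernel of f, centrality modulo delta of alpha over
    beta passes to their joins with the kernel, because delta is central over
    everything modulo itself; and for congruences above the kernel, matrices
    can be lifted along f, so that centrality can be tested on either side. *)
Lemma tc_commutator_law S (V : set (algebra S)) :
  is_variety V -> congruence_modular V -> commutator_law V (@tc_commutator S).
Proof.
move=> varV modV; split=> [A VA alpha beta p h|A B f VA VB sf alpha beta].
  split; apply: h; first exact: centralizes_self_l.
  exact: (centralizes_self_r varV modV VA).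
set K := cker f; set alpha1 := cjoin alpha K; set beta1 := cjoin beta K.
have KP (theta : con B) : K `<=` cpreim f theta.
  by case=> x y /= ->; exact: con_refl.
have fP (theta : con A) : theta `<=` cpreim f (cimage f theta).
  by move=> p tp; apply: cgen_sub; exists p.
apply: con_eq.
  apply: cjoin_le (KP _) => -[x y] h e Ze.
  apply: (h (cpreim f e)) => a b c d m.
  apply: Ze; apply: matrix_hom m => p hp; apply: fP; exact: cjoin_l.
set delta := cjoin _ K; have Kd : K `<=` delta by exact: cjoin_r.
have Z0 : centralizes alpha beta delta.
  apply: (centralizes_up varV modV VA) (@tc_commutator_centralizes _ _ _ _).
  exact: cjoin_l.
have Zr : centralizes alpha beta1 delta.
  apply: (centralizes_join) => //.
  exact: (centralizes_self_r varV modV VA).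
have Z1 : centralizes alpha1 beta1 delta.
  apply: (centralizes_sym varV modV VA); apply: centralizes_join.
    exact: (centralizes_sym varV modV VA).
  exact: (centralizes_self_r varV modV VA).
have dE x y : con_set (cimage f delta) (f x, f y) -> con_set delta (x, y).
  rewrite cimageE // => -[[a b] /= ab [fa fb]].
  have xa : con_set delta (x, a) by exact: Kd.
  have yb : con_set delta (b, y) by exact: Kd.
  exact: (@con_trans _ _ delta x a y xa (@con_trans _ _ delta a b y ab yb)).
case=> x y h; apply/dE; apply: h => s t u v m.
have [a [b [c [d [<- <- <- <- m1]]]]] :=
  matrix_lift sf (@cjoin_r _ _ _ _) (@cjoin_r _ _ _ _) m.
by move=> /dE ab; exact: (fP delta (c, d) (Z1 _ _ _ _ m1 ab)).
Qed.

(** Let p0 and p1 be the projections of the algebra of alpha-related pairs.  The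
    law for p1 computes c alpha beta from the value of c at the kernel of p0 and
    D, because p1 sends the joins of these with its kernel to alpha and beta;
    and this value is below the meet of the two arguments. *)
Lemma law_le_centralizes S (V : set (algebra S))
    (c : forall A : algebra S, con A -> con A -> con A)
    (A : algebra S) (alpha beta delta : con A) :
  is_variety V -> congruence_modular V -> V A ->
  commutator_law V c -> centralizes alpha beta delta ->
  c A alpha beta `<=` delta.
Proof.
move=> varV modV VA [c1 c2] /(centralizes_sub _ _ _ varV modV VA) H.
have VR := pair_alg_variety alpha varV VA.
pose p0 := fst_hom alpha; pose p1 := snd_hom alpha.
pose D := diag_con alpha beta.
have imE (theta : con (pair_alg alpha)) (gamma : con A) :
    theta = cpreim p1 gamma -> cimage p1 theta = gamma.
  move=> ->; apply: con_eq; first by apply: cgen_min => _ [q h <-].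
  case=> x y xy; apply: cgen_sub.
  by exists (diag_hom alpha x, diag_hom alpha y).
have E0 : cimage p1 (cjoin (cker p0) (cker p1)) = alpha.
  apply: imE; apply: con_eq.
    apply: cjoin_le => -[[[x y] xy] [[u v] uv]] /= e; subst.
      exact: con_trans (con_sym xy) uv.
    exact: con_refl.
  case=> -[[x y] xy] [[u v] uv] /= yv.
  have xv : con_set alpha (x, v) by exact: con_trans xy yv.
  apply: (@con_trans _ _ (cjoin (cker p0) (cker p1)) _ (pairof xv)).
    exact: cjoin_l.
  exact: cjoin_r.
have E1 : cimage p1 (cjoin D (cker p1)) = beta.
  apply: imE; apply: con_eq.
    apply: cjoin_le.
      by apply: cgen_min => _ [[a b] ab <-].
    by case=> p q /= ->; exact: con_refl.
  case=> p q /= pq.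
  apply: (@con_trans _ _ (cjoin D (cker p1)) _ (diag_hom alpha (sval p).2)).
    exact: cjoin_r.
  apply: (@con_trans _ _ (cjoin D (cker p1)) _ (diag_hom alpha (sval q).2));
    last exact: cjoin_r.
  by apply: cjoin_l; apply: cgen_sub; exists ((sval p).2, (sval q).2).
have := c2 _ _ p1 VR VA (@snd_hom_surj _ _ alpha) (cker p0) D.
rewrite E0 E1 => E [x y] xy.
suff : con_set (cpreim p1 delta) (diag_hom alpha x, diag_hom alpha y) by [].
have : con_set (cpreim p1 (c A alpha beta))
  (diag_hom alpha x, diag_hom alpha y).
  by [].
rewrite -E; apply: cjoin_le => -[p q]; last by move=> /= ->; exact: con_refl.
by case/(c1 _ VR); exact: H.
Qed.

Lemma commutator_le S (V : set (algebra S)) (A : algebra S)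
    (alpha beta delta : con A) :
  is_variety V -> congruence_modular V -> V A ->
  commutator V alpha beta `<=` delta <-> centralizes alpha beta delta.
Proof.
move=> varV modV VA; split=> [h|Z].
  apply: (centralizes_up varV modV VA) (@tc_commutator_centralizes _ _ _ _).
  apply: subset_trans h.
  exact: commutator_max (tc_commutator_law varV modV) _ _ _.
exact: law_le_centralizes varV modV VA (commutator_lawP V) Z.
Qed.

(** * Compact congruences *)

Lemma cjoins_mono S (A : algebra S) (F G : set (con A)) :
  F `<=` G -> cjoins F `<=` cjoins G.
Proof. by move=> FG; apply: cjoins_le => theta /FG; exact: cjoins_ub. Qed.

Lemma cjoins_finitary S (A : algebra S) (F : set (con A)) (p : A * A) :
  con_set (cjoins F) p ->
  exists G : set (con A), [/\ finite_set G, G `<=` F & con_set (cjoins G) p].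
Proof.
pose K := [set p : A * A |
  exists G : set (con A), [/\ finite_set G, G `<=` F & con_set (cjoins G) p]].
have K1 x : K (x, x).
  exists set0; split; [exact: finite_set0|exact: sub0set|exact: con_refl].
have K2 x y : K (x, y) -> K (y, x).
  by case=> G [fG GF h]; exists G; split=> //; exact: con_sym.
have K3 x y z : K (x, y) -> K (y, z) -> K (x, z).
  move=> [G [fG GF xy]] [H [fH HF yz]]; exists (G `|` H); split.
  - by rewrite finite_setU.
  - by move=> t [/GF|/HF].
  - apply: (@con_trans _ _ (cjoins (G `|` H)) x y z).
      by apply: cjoins_mono xy; exact: subsetUl.
    by apply: cjoins_mono yz; exact: subsetUr.
have K4 f (u v : 'I_(arity f) -> A) :
    (forall i, K (u i, v i)) -> K (op A f u, op A f v).
  move=> /choice[G uv]; exists (\bigcup_(i in setT) G i); split.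
  - by apply: bigcup_finite => [|i _]; [exact: finite_finset|case: (uv i)].
  - by move=> t [i _]; have [_ h _] := uv i; exact: h.
  - apply: (@con_op _ _ (cjoins (\bigcup_(i in setT) G i))) => i.
    have [_ _] := uv i; apply: cjoins_mono => t Gt; by exists i.
apply: (@cjoins_le _ _ F (Con K1 K2 K3 K4)) => theta Ft q tq.
exists [set theta]; split; [exact: finite_set1|by move=> _ ->|].
exact: cjoins_ub tq.
Qed.

Lemma cgen_compact S (A : algebra S) (R : set (A * A)) :
  finite_set R -> compact_con (cgen R).
Proof.
move=> fR F RF.
have /choice[G GP] : forall p, exists G : set (con A),
    R p -> [/\ finite_set G, G `<=` F & con_set (cjoins G) p].
  move=> p; have [Rp|nRp] := pselect (R p); last by exists set0.
  by have [G GP] := cjoins_finitary (RF p (cgen_sub Rp)); exists G.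
exists (\bigcup_(p in R) G p); split.
- by apply: bigcup_finite => // p /GP[].
- by move=> t [p /GP[_ h _]]; exact: h.
- apply: cgen_min => p Rp; have [_ _] := GP p Rp.
  by apply: cjoins_mono => t Gt; exists p.
Qed.

(** Principal congruences are compact, so compact congruences suffice to test
    the order. *)
Lemma compact_separates S (A : algebra S) (alpha beta : con A) :
  ~ alpha `<=` beta ->
  exists gamma : con A,
    [/\ compact_con gamma, gamma `<=` alpha & ~ gamma `<=` beta].
Proof.
move=> /existsNP[p /not_implyP[ap bp]]; exists (cgen [set p]); split.
- exact/cgen_compact/finite_set1.
- by apply: cgen_min => _ ->.
- by move=> h; apply/bp/h/cgen_sub.
Qed.

Lemma finite_chain_ub T (R : T -> T -> Prop) (F G : set T) :
  (forall x, R x x) -> (forall x y z, R x y -> R y z -> R x z) ->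
  F !=set0 -> total_on F R -> finite_set G -> G `<=` F ->
  exists2 u, F u & forall x, G x -> R x u.
Proof.
move=> R1 R2 [x0 Fx0] totF /finite_setP[n].
move=> /card_set_bijP[f [fG finj _]] GF.
suff /(_ n)[u Fu uP] : forall k, exists2 u, F u &
    forall x, G x -> (f x < k)%N -> R x u.
  by exists u => // x Gx; apply: uP => //; exact: fG.
elim=> [|k [u Fu uP]]; first by exists x0.
have [[y [Gy fy]]|no] := pselect (exists y, G y /\ f y = k); last first.
  exists u => // x Gx; rewrite ltnS leq_eqVlt => /orP[/eqP fx|]; last exact: uP.
  by case: no; exists x.
have yE x : G x -> f x = k -> x = y.
  by move=> Gx fx; apply: finj; rewrite ?inE // fx.
have [uy|yu] := totF _ _ Fu (GF _ Gy).
  exists y => [|x Gx]; first exact: GF.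
  rewrite ltnS leq_eqVlt => /orP[/eqP/(yE _ Gx)->//|fx].
  exact: R2 (uP _ Gx fx) uy.
exists u => // x Gx; rewrite ltnS leq_eqVlt => /orP[/eqP/(yE _ Gx)->//|].
exact: uP.
Qed.

Lemma compact_chain S (A : algebra S) (t : con A) (F : set (con A)) :
  compact_con t -> F !=set0 ->
  total_on F (fun a b : con A => a `<=` b) -> t `<=` cjoins F ->
  exists2 u : con A, F u & t `<=` u.
Proof.
move=> ct F0 totF /ct[G [fG GF tG]].
have [|u Fu uP] := @finite_chain_ub _ (fun a b : con A => a `<=` b) F G
  (fun x => @subset_refl _ _) _ F0 totF fG GF.
  by move=> x y z; exact: subset_trans.
by exists u => //; apply: subset_trans tG _; exact: cjoins_le.
Qed.

(** Zorn's lemma for a preorder on a nonempty subset, with upper bounds required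
    of nonempty chains only: the union of the empty chain of congruences, or the
    meet of the empty chain of primes, need not have the desired property. *)
Lemma zorn_in T (R : T -> T -> Prop) (P : set T) (p0 : T) :
  (forall x, R x x) -> (forall x y z, R x y -> R y z -> R x z) -> P p0 ->
  (forall F, F `<=` P -> F !=set0 -> total_on F R ->
     exists2 u, P u & forall x, F x -> R x u) ->
  exists2 m, P m & forall t, P t -> R m t -> R t m.
Proof.
move=> R1 R2 Pp0 ub.
pose Q := {x | P x}; pose r (x y : Q) := `[< R (sval x) (sval y) >].
have [|x y z /asboolP xy /asboolP yz|F totF|m mP] :=
    @ZL_preorder Q (exist _ p0 Pp0) r.
- by move=> x; apply/asboolP.
- by apply/asboolP; exact: R2 yz.
- have [F0|/set0P/negP/negPn/eqP->] := pselect (F !=set0); last first.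
    by exists (exist _ p0 Pp0).
  have [_ [x _ <-]|||u Pu uP] := ub [set sval x | x in F].
  + exact: svalP.
  + by case: F0 => x Fx; exists (sval x); exists x.
  + move=> _ _ [x Fx <-] [y Fy <-].
    by have [/asboolP|/asboolP] := totF x y Fx Fy; [left|right].
  + by exists (exist _ u Pu) => s Fs; apply/asboolP/uP; exists s.
- exists (sval m); first exact: svalP.
  move=> t Pt mt; apply/asboolP; apply: (mP (exist _ t Pt)); exact/asboolP.
Qed.

(** * The commutator as an operation on the congruence lattice *)

Section Commutator.
Context S (V : set (algebra S)) (varV : is_variety V)
  (modV : congruence_modular V) (A : algebra S) (VA : V A).
Implicit Types alpha beta gamma delta phi psi theta : con A.
Local Notation C := (commutator V).
Local Notation rho0 := (radical V (cdelta A)).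

Let comm_leP alpha beta delta :
  C alpha beta `<=` delta <-> centralizes alpha beta delta.
Proof. exact: commutator_le. Qed.

Lemma comm_l alpha beta : C alpha beta `<=` alpha.
Proof. by move=> p /((commutator_lawP V).1 A VA)[]. Qed.

Lemma comm_r alpha beta : C alpha beta `<=` beta.
Proof. by move=> p /((commutator_lawP V).1 A VA)[]. Qed.

Lemma comm_sym alpha beta : C alpha beta `<=` C beta alpha.
Proof. by apply/comm_leP/(centralizes_sym varV modV VA)/comm_leP. Qed.

Lemma comm_mono alpha beta alpha' beta' :
  alpha `<=` alpha' -> beta `<=` beta' -> C alpha beta `<=` C alpha' beta'.
Proof.
move=> aa bb; apply/comm_leP; apply: centralizes_le aa bb _.
exact/comm_leP.
Qed.

Lemma comm_joinr alpha beta beta' delta :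
  C alpha beta `<=` delta -> C alpha beta' `<=` delta ->
  C alpha (cjoin beta beta') `<=` delta.
Proof. by move=> /comm_leP h /comm_leP k; apply/comm_leP/centralizes_join. Qed.

Lemma comm_join_join phi alpha beta :
  C (cjoin phi alpha) (cjoin phi beta) `<=` cjoin phi (C alpha beta).
Proof.
apply: comm_joinr.
  by apply: subset_trans (@comm_r _ _) (@cjoin_l _ _ _ _).
apply: subset_trans (@comm_sym _ _) _; apply: comm_joinr.
  by apply: subset_trans (@comm_r _ _) (@cjoin_l _ _ _ _).
exact: subset_trans (@comm_sym _ _) (@cjoin_r _ _ _ _).
Qed.

Lemma residP alpha beta gamma :
  gamma `<=` resid V alpha beta <-> C alpha gamma `<=` beta.
Proof.
split=> [h|h]; last by apply: cjoins_ub.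
apply: subset_trans (comm_mono (@subset_refl _ _) h) _.
by apply/comm_leP/centralizes_joins => d /comm_leP.
Qed.

(** For beta = nabla all diagonal pairs fall in one class of D, so that D is
    full by semidegeneracy and relates (x, x) to (x, y) for every pair (x, y) in
    gamma; centrality turns this into (x, y) being in the commutator. *)
Lemma comm_nabla (semiV : semidegenerate V) gamma :
  gamma `<=` C gamma (cnabla A).
Proof.
case=> x y xy.
have /(centralizes_sub _ _ _ varV modV VA) H :
  centralizes gamma (cnabla A) (C gamma (cnabla A)) by exact/comm_leP.
apply: (H (diag_hom gamma x) (pairof xy)) => //.
apply: (@semidegenerate_full _ _ _ (diag_con gamma (cnabla A))
  (diag_hom gamma x) varV semiV (pair_alg_variety gamma varV VA)) => f.
by rewrite -homP; apply: cgen_sub; exists (op A f (fun=> x), x).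
Qed.

(** The congruence generated by the pairs (f(a, ..., a), a) makes the class of a
    a subalgebra, hence is full; the signature being finite, these pairs are
    finitely many. *)
Lemma nabla_compact (semiV : semidegenerate V) : compact_con (cnabla A).
Proof.
have [a] := carrier_inhabited A.
pose R : set (A * A) := [set (op A f (fun=> a), a) | f in setT].
suff -> : cnabla A = cgen R.
  by apply/cgen_compact/finite_image; exact: finite_finset.
apply: con_eq => // -[x y] _.
apply: (semidegenerate_full (a := a) varV semiV VA) => f.
by apply: cgen_sub; exists f.
Qed.

(** * Prime congruences *)

(** Krull's separation argument: a congruence maximal among those above theta
    with no member of T below it is prime.  Compactness of the members of T
    makes the condition pass to joins of chains. *)
Lemma prime_avoiding (T : set (con A)) theta :
  T !=set0 -> T `<=` @compact_con S A ->
  (forall s t, T s -> T t -> T (C s t)) ->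
  (forall t, T t -> ~ t `<=` theta) ->
  exists phi, [/\ Spec V phi, theta `<=` phi & forall t, T t -> ~ t `<=` phi].
Proof.
move=> [t0 Tt0] Tc TM Tth.
pose P := [set phi : con A | theta `<=` phi /\ forall t, T t -> ~ t `<=` phi].
have [| | |F FP F0 totF|phi [thphi Tphi] phimax] :=
    @zorn_in _ (fun a b : con A => a `<=` b) P theta.
- by move=> x.
- by move=> x y z; exact: subset_trans.
- by split.
- exists (cjoins F); last by move=> x Fx; exact: cjoins_ub.
  split.
    case: F0 => u Fu; apply: subset_trans (@cjoins_ub _ _ _ _ Fu).
    by case: (FP _ Fu).
  move=> t Tt /(compact_chain (Tc _ Tt) F0 totF)[u /FP[_ h] tu].
  exact: h tu.
exists phi; split=> //; split=> [E|alpha beta ab].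
  by apply: (Tphi _ Tt0); rewrite E.
apply: contrapT => /not_orP[na nb].
have above gamma : ~ gamma `<=` phi -> exists2 t, T t & t `<=` cjoin phi gamma.
  move=> ng; apply: contrapT => no; apply: ng.
  apply: subset_trans (@cjoin_r _ _ phi gamma) _.
  apply: phimax; last exact: cjoin_l.
  split; first by apply: subset_trans (@cjoin_l _ _ _ _).
  by move=> t Tt tg; apply: no; exists t.
have [s Ts sa] := above _ na; have [t Tt tb] := above _ nb.
apply: (Tphi _ (TM _ _ Ts Tt)); apply: subset_trans (comm_mono sa tb) _.
by apply: subset_trans (@comm_join_join _ _ _) _; exact: cjoin_le.
Qed.

Lemma prime_above (semiV : semidegenerate V) theta :
  theta <> cnabla A -> exists2 phi, Spec V phi & theta `<=` phi.
Proof.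
move=> nth.
have [|_ ->|_ _ -> ->|_ -> h|phi [? ? _]] :=
    @prime_avoiding [set cnabla A] theta; last by exists phi.
- by exists (cnabla A).
- exact: nabla_compact.
- by apply: con_eq => //; exact: comm_nabla.
- by apply: nth; exact: con_eq.
Qed.

Lemma le_radical0 gamma :
  gamma `<=` rho0 <-> forall phi, Spec V phi -> gamma `<=` phi.
Proof.
split=> [h phi sphi p /h|h p gp phi [sphi _]]; last exact: h gp.
by apply; split=> // -[x y] /= ->; exact: con_refl.
Qed.

Lemma prime_meet phi alpha beta : Spec V phi ->
  C alpha beta `<=` phi <-> alpha `<=` phi \/ beta `<=` phi.
Proof.
move=> [_ h]; split=> [/h//|[]]; apply: subset_trans; first exact: comm_l.
exact: comm_r.
Qed.

Lemma resid_le_prime phi alpha :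
  Spec V phi -> ~ alpha `<=` phi -> resid V alpha rho0 `<=` phi.
Proof.
move=> sphi na.
have /residP/le_radical0/(_ _ sphi) := @subset_refl _ (resid V alpha rho0).
by case/(prime_meet _ _ sphi).
Qed.

Lemma minimal_prime_below phi :
  Spec V phi -> exists2 psi, minimal_prime V psi & psi `<=` phi.
Proof.
move=> sphi.
pose P := [set psi | Spec V psi /\ psi `<=` phi].
have [| | |F FP [u0 Fu0] totF|psi [spsi psiphi] psimin] :=
    @zorn_in _ (fun a b : con A => b `<=` a) P phi.
- by move=> x.
- by move=> x y z xy yz; exact: subset_trans yz xy.
- by split.
- have meet_le u : F u -> cmeets F `<=` u by move=> Fu p; apply.
  have [[nu0 _] u0phi] := FP _ Fu0.
  exists (cmeets F); last exact: meet_le.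
  split; last by apply: subset_trans u0phi; exact: meet_le.
  split=> [E|alpha beta ab].
    by apply: nu0; apply: con_eq => //; rewrite -E; exact: meet_le.
  apply: contrapT => /not_orP[na nb].
  have out gamma : ~ gamma `<=` cmeets F -> exists2 u, F u & ~ gamma `<=` u.
    move=> ng; apply: contrapT => no; apply: ng => p gp u Fu.
    by apply: contrapT => up; apply: no; exists u => // /(_ p gp).
  have [u Fu au] := out _ na; have [v Fv bv] := out _ nb.
  have key w : F w -> w `<=` u -> w `<=` v -> False.
    move=> Fw wu wv; have [sw _] := FP _ Fw.
    have /(prime_meet _ _ sw)[aw|bw] := subset_trans ab (meet_le _ Fw).
      by apply: au; exact: subset_trans aw wu.
    by apply: bv; exact: subset_trans bw wv.
  by have [vu|uv] := totF _ _ Fu Fv; [exact: key Fv vu _|exact: key Fu _ uv].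
exists psi => //; split=> // chi schi chipsi.
apply: con_eq => //; apply: psimin => //; split=> //.
exact: subset_trans chipsi psiphi.
Qed.

Section MP.
Context (semiV : semidegenerate V) (compact_comm : forall alpha beta,
  compact_con alpha -> compact_con beta -> compact_con (C alpha beta)).

(** The multiplicative set to avoid is generated by alpha and the compact
    congruences not below phi.  Avoiding the latter forces the prime below phi;
    no member of the set lies below the radical because the residual of alpha is
    below phi. *)
Lemma prime_below_omitting phi alpha :
  Spec V phi -> compact_con alpha -> resid V alpha rho0 `<=` phi ->
  exists psi, [/\ Spec V psi, psi `<=` phi & ~ alpha `<=` psi].
Proof.
move=> sphi ca rphi; have [nphi _] := sphi.
have cN := nabla_compact semiV.
have Nphi : ~ cnabla A `<=` phi by move=> h; apply: nphi; exact: con_eq.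
(* up to the radical, t contains the product of alpha and some s not below phi;
   saying so in terms of primes avoids powers of alpha and iterated products *)
pose T := [set t : con A | compact_con t /\ exists s : con A,
  [/\ compact_con s, ~ s `<=` phi &
      forall psi, Spec V psi -> t `<=` psi -> alpha `<=` psi \/ s `<=` psi]].
have Ta : T alpha by split=> //; exists (cnabla A); split=> // psi _; left.
have [|t []//|t t'|t [ct [s [cs sphi' H]]] trho|psi [spsi _ Tpsi]] :=
    @prime_avoiding T rho0.
- by exists alpha.
- move=> [ct [s [cs ns H]]] [ct' [s' [cs' ns' H']]].
  split; first exact: compact_comm.
  exists (C s s'); split; first exact: compact_comm.
    by move=> /(prime_meet _ _ sphi)[].
  move=> psi spsi /(prime_meet _ _ spsi)[/(H _ spsi)|/(H' _ spsi)] [|h].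
  + by left.
  + by right; apply/prime_meet => //; left.
  + by left.
  + by right; apply/prime_meet => //; right.
- apply: sphi'; apply: subset_trans rphi; apply/residP/le_radical0 => psi spsi.
  by apply/(prime_meet _ _ spsi)/H => //; exact: (le_radical0 t).1 trho _ spsi.
exists psi; split=> //; last exact: Tpsi.
apply: contrapT => /compact_separates[s [cs spsi' sphi']].
apply: Tpsi spsi'; split=> //; exists s; split=> // chi _; by right.
Qed.

(** A prime above both residuals has primes below it omitting alpha and beta
    respectively; by uniqueness these contain the same minimal prime, which then
    contains neither although it contains their commutator. *)
Lemma mp_comaximal : mp_algebra V A ->
  forall alpha beta, compact_con alpha -> compact_con beta ->
  C alpha beta `<=` rho0 ->
  cjoin (resid V alpha rho0) (resid V beta rho0) = cnabla A.
Proof.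
move=> mp alpha beta ca cb ab.
apply: contrapT => /(prime_above semiV)[phi sphi Jphi].
have [psi [[[spsi _] psiphi] psi_uniq]] := mp _ sphi.
have omit gamma : compact_con gamma -> resid V gamma rho0 `<=` phi ->
    ~ gamma `<=` psi.
  move=> cg rphi.
  have [chi [schi chiphi gchi]] := prime_below_omitting sphi cg rphi.
  have [mu mmu muchi] := minimal_prime_below schi.
  rewrite (psi_uniq mu); last by split=> //; exact: subset_trans muchi chiphi.
  by move=> gmu; apply: gchi; exact: subset_trans gmu muchi.
have /(prime_meet _ _ spsi)[] := (le_radical0 _).1 ab _ spsi.
  by apply: omit => //; exact: subset_trans (@cjoin_l _ _ _ _) Jphi.
by apply: omit => //; exact: subset_trans (@cjoin_r _ _ _ _) Jphi.
Qed.

(** Minimality of psi prevents the residual of any compact alpha below psi from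
    being below psi, which provides a compact beta; the two residuals are then
    split between the two minimal primes, both below phi. *)
Lemma comaximal_mp :
  (forall alpha beta, compact_con alpha -> compact_con beta ->
     C alpha beta `<=` rho0 ->
     cjoin (resid V alpha rho0) (resid V beta rho0) = cnabla A) ->
  mp_algebra V A.
Proof.
move=> H phi sphi; have [psi mpsi psiphi] := minimal_prime_below sphi.
exists psi; split=> // chi [mchi chiphi]; apply: contrapT => neq.
have [spsi minpsi] := mpsi; have [schi minchi] := mchi.
have : ~ psi `<=` chi by move=> h; apply: neq; exact: minchi.
case/compact_separates=> alpha [ca apsi achi].
have : ~ resid V alpha rho0 `<=` psi.
  case/(prime_below_omitting spsi ca) => nu [snu nupsi anu].
  by apply: anu; rewrite (minpsi nu).
case/compact_separates=> beta [cb /residP ab bpsi].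
have [nphi _] := sphi; apply: nphi; apply: con_eq => //.
rewrite -(H _ _ ca cb ab); apply: cjoin_le.
  by apply: subset_trans chiphi; exact: resid_le_prime.
by apply: subset_trans psiphi; exact: resid_le_prime.
Qed.

(** For compact gamma below the right-hand side, comaximality of the residuals
    of [alpha, gamma] and [beta, gamma], multiplied by gamma, gives the
    inclusion.  The commutator is not associative, but modulo the radical the
    products are compared on primes, where the bracketing is immaterial. *)
Lemma comaximal_resid_comm :
  (forall alpha beta, compact_con alpha -> compact_con beta ->
     C alpha beta `<=` rho0 ->
     cjoin (resid V alpha rho0) (resid V beta rho0) = cnabla A) ->
  forall alpha beta, compact_con alpha -> compact_con beta ->
  cjoin (resid V alpha rho0) (resid V beta rho0) = resid V (C alpha beta) rho0.
Proof.
move=> H alpha beta ca cb.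
have rad_resid gamma : C gamma (resid V gamma rho0) `<=` rho0 by exact/residP.
apply: con_eq.
  apply: cjoin_le; apply/residP.
    apply: subset_trans (@rad_resid alpha).
    exact: comm_mono (@comm_l _ _) (@subset_refl _ _).
  apply: subset_trans (@rad_resid beta).
  exact: comm_mono (@comm_r _ _) (@subset_refl _ _).
apply: contrapT => /compact_separates[gamma [cg /residP gab]]; apply.
have E : cjoin (resid V (C alpha gamma) rho0) (resid V (C beta gamma) rho0)
    = cnabla A.
  apply: H; try exact: compact_comm.
  apply/le_radical0 => psi spsi.
  have /(prime_meet _ _ spsi) := (le_radical0 _).1 gab _ spsi.
  move=> h; apply/(prime_meet _ _ spsi).
  case: h => [/(prime_meet _ _ spsi)[h|h]|h].
  - by left; apply/(prime_meet _ _ spsi); left.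
  - by right; apply/(prime_meet _ _ spsi); left.
  - by left; apply/(prime_meet _ _ spsi); right.
have shift delta :
    C gamma (resid V (C delta gamma) rho0) `<=` resid V delta rho0.
  apply/residP/le_radical0 => psi spsi.
  have /(prime_meet _ _ spsi) :=
    (le_radical0 _).1 (rad_resid (C delta gamma)) _ spsi.
  move=> h; apply/(prime_meet _ _ spsi).
  case: h => [/(prime_meet _ _ spsi)[h|h]|h]; first by left.
  - by right; apply/(prime_meet _ _ spsi); left.
  - by right; apply/(prime_meet _ _ spsi); right.
apply: subset_trans (@comm_nabla semiV gamma) _; rewrite -E; apply: comm_joinr.
  exact: subset_trans (@shift _) (@cjoin_l _ _ _ _).
exact: subset_trans (@shift _) (@cjoin_r _ _ _ _).
Qed.

End MP.
End Commutator.

Theorem theorem9p16 (S : signature) (V : set (algebra S))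
  (varV : is_variety V) (modV : congruence_modular V)
  (semiV : semidegenerate V)
  (A : algebra S) (VA : V A)
  (compact_comm : forall alpha beta : con A,
     compact_con alpha -> compact_con beta ->
     compact_con (commutator V alpha beta)) :
  let rho0 := radical V (cdelta A) in
  [<-> mp_algebra V A;
       forall alpha beta : con A, compact_con alpha -> compact_con beta ->
         commutator V alpha beta `<=` rho0 ->
         cjoin (resid V alpha rho0) (resid V beta rho0) = cnabla A;
       forall alpha beta : con A, compact_con alpha -> compact_con beta ->
         cjoin (resid V alpha rho0) (resid V beta rho0) =
         resid V (commutator V alpha beta) rho0;
       forall alpha : con A, compact_con alpha ->
         w_pure V (resid V alpha rho0)].
Proof.
move=> rho0; split; last split; last split.
- exact: mp_comaximal.
- exact: comaximal_resid_comm.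
- move=> H alpha ca beta cb /(residP varV modV VA) ab; rewrite H //.
  apply: con_eq => //; apply/(residP varV modV VA).
  by apply: subset_trans ab; exact: comm_l.
- move=> H; apply: comaximal_mp => // alpha beta ca cb ab.
  by apply: H => //; exact/(residP varV modV VA).
Qed.
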